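(* Let $V>0$, let $D^{\max}=\max\{D_1,\ldots,D_n\}$ and let $Q^{l}=\lceil V\rceil(D^{\max}+2p^{\max}+e^{\max})$. Let $\mathbf{p}[t]$ and $Q[t]$ be produced by Algorithm 1 (defined in the context) with parameter $V$, and let the battery level $E[t]$ evolve from $E[0]$ by $E[t]=\min\{E[t-1]-\sum_{i=1}^n p_i[t]+e[t],\,E^{\max}\}$ for $t\in\{1,2,\ldots\}$. If $E[0]=E^{\max}\ge Q^{l}+p^{\max}$, then the energy availability constraint $$\sum_{i=1}^n p_i[t]\le E[t-1]$$ holds for every $t\in\{1,2,\ldots\}$. Moreover, $$E[t]=Q[t]+E^{\max},\qquad \forall t\in\{0,1,2,\ldots\}.$$
   Context: Setting. $n\ge 1$ is an integer and $p^{\max}>0$, $e^{\max}>0$ are constants; $\mathcal{P}=\{\mathbf{p}\in\mathbb{R}^n:\sum_{i=1}^n p_i\le p^{\max},\ p_i\ge 0\ \forall i\}$. States are $\omega=(e,\mathbf{s})\in\Omega$, where $e$ (harvested energy) is a real number and $\mathbf{s}$ is a device state; $\omega[t]=(e[t],\mathbf{s}[t])\in\Omega$, $t\in\{1,2,\ldots\}$, is the (realized) state sequence, with $0\le e[t]\le e^{\max}$ for all $t$. For each $\omega\in\Omega$, the utility $U(\cdot;\omega):\mathcal{P}\to\mathbb{R}$ is continuous and concave. For each $\mathbf{p}\in\mathcal{P}$, $\omega\in\Omega$, $\nabla_{\mathbf{p}}U(\mathbf{p};\omega)$ denotes a chosen subgradient of this concave function (the gradient if differentiable), i.e. $U(\mathbf{q};\omega)\le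 U(\mathbf{p};\omega)+(\nabla_{\mathbf{p}}U(\mathbf{p};\omega))^{\mathsf T}(\mathbf{q}-\mathbf{p})$ for all $\mathbf{q}\in\mathcal{P}$. There are constants $D_1,\ldots,D_n>0$ such that the $i$-th component of $\nabla_{\mathbf{p}}U(\mathbf{p};\omega)$ has absolute value at most $D_i$ for all $\mathbf{p}\in\mathcal{P},\omega\in\Omega$. $E^{\max}$ is the battery capacity. $\lceil V\rceil$ is the smallest integer no less than $V$. Algorithm 1 (parameter $V>0$). Initialize $Q[0]=0$ and $\mathbf{p}[1]=\mathbf{0}$. At the end of each slot $t\in\{1,2,\ldots\}$, observe $\omega[t]$ and set $$Q[t]=\min\Big\{Q[t-1]+e[t]-\sum_{i=1}^n p_i[t],\,0\Big\},$$ $$\mathbf{p}[t+1]=\mathrm{Proj}_{\mathcal{P}}\Big\{\mathbf{p}[t]+\tfrac1V\nabla_{\mathbf{p}}U(\mathbf{p}[t];\omega[t])+\tfrac1{V^2}Q[t]\mathbf{1}\Big\},$$ where $\mathrm{Proj}_{\mathcal{P}}$ is Euclidean projection onto $\mathcal{P}$ and $\mathbf{1}$ is the all-ones vector. *)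

(* Defs.v *)
From HB Require Import structures.
From mathcomp Require Import all_boot all_order all_algebra.
From mathcomp Require Import all_classical all_reals all_analysis.

Set Implicit Arguments.
Unset Strict Implicit.
Unset Printing Implicit Defensive.

Import Order.TTheory GRing.Theory Num.Theory.
Import numFieldNormedType.Exports.

Local Open Scope classical_set_scope.
Local Open Scope ring_scope.

Section Energy.
Context {R : realType} {n : nat} {S : Type}.
Implicit Types (x y p q : 'rV[R]_n) (P : set 'rV[R]_n).

Definition power_sum p : R := \sum_(i < n) p 0 i.

Definition dot x y : R := \sum_(i < n) x 0 i * y 0 i.

(* The norm `|x| of the library is the sup norm on 'rV[R]_n; the Euclidean
   projection needs the l2 norm. *)
Definition norm2 x : R := Num.sqrt (dot x x).

Definition powers (pmax : R) : set 'rV[R]_n :=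
  [set p | power_sum p <= pmax /\ forall i, 0 <= p 0 i].

(* y = Proj_P{x}, as a relation; on a nonempty closed convex P such a y exists
   and is unique. *)
Definition is_proj P x y : Prop :=
  P y /\ forall q, P q -> norm2 (y - x) <= norm2 (q - x).

Definition concave_on P (f : 'rV[R]_n -> R) : Prop :=
  convex_function (R := R) (E := 'rV[R]_n) P (fun p => - f p).

Definition is_subgradient P (f : 'rV[R]_n -> R) p (g : 'rV[R]_n) : Prop :=
  forall q, P q -> f q <= f p + dot g (q - p).

(* The default 0 is harmless: it is only used with n >= 1 and all D i > 0. *)
Definition Dmax (D : 'I_n -> R) : R := \big[Num.max/0]_(i < n) D i.

Definition Qlow (V pmax emax : R) (D : 'I_n -> R) : R :=
  (Num.ceil V)%:~R * (Dmax D + 2 * pmax + emax).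

(* A state is w = (e, s), so the energy harvested in slot t is (omega t).1.
   Slots are numbered from 1: slot t is written t.+1 with t >= 0, and the values
   omega 0 and p 0 are never used. *)
Record algorithm1 (pmax V : R) (grad : 'rV[R]_n -> R * S -> 'rV[R]_n)
    (omega : nat -> R * S) (Q : nat -> R) (p : nat -> 'rV[R]_n) : Prop := {
  alg_Q0 : Q 0%N = 0;
  alg_p1 : p 1%N = 0;
  alg_Q : forall t, Q t.+1 = Num.min (Q t + (omega t.+1).1 - power_sum (p t.+1)) 0;
  alg_p : forall t, is_proj (powers pmax)
    (p t.+1 + V^-1 *: grad (p t.+1) (omega t.+1)
            + (V ^+ 2)^-1 *: (Q t.+1 *: const_mx 1))
    (p t.+2) }.

Definition battery (Emax : R) (omega : nat -> R * S) (p : nat -> 'rV[R]_n)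
    (E : nat -> R) : Prop :=
  forall t, E t.+1 = Num.min (E t - power_sum (p t.+1) + (omega t.+1).1) Emax.

End Energy.

(* Main.v *)
Require Import Defs.
From HB Require Import structures.
From mathcomp Require Import all_boot all_order all_algebra.
From mathcomp Require Import all_classical all_reals all_analysis.
From mathcomp Require Import ring lra.

Set Implicit Arguments.
Unset Strict Implicit.
Unset Printing Implicit Defensive.

Import Order.TTheory GRing.Theory Num.Theory.
Import numFieldNormedType.Exports.

Local Open Scope classical_set_scope.
Local Open Scope ring_scope.

(** Clipping one coordinate never leaves the power region, so a projected
    coordinate is at most the positive part of the original one. Hence, as long as
    [Q <= - V (Dmax + pmax)], every power drops by at least [pmax / V] per slot
    until it is [0]. Since [Q] loses at most [pmax] per slot, a value of [Q] below
    [- Qlow] would be preceded by [ceil V] such slots; all powers are then [0]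
    and [Q] cannot have decreased. So [- Qlow <= Q], and the battery level, which
    is [Q] shifted by [Emax], always covers [pmax]. *)

Section Projection.
Context {R : realType} {n : nat}.
Implicit Types (x y p : 'rV[R]_n) (pmax : R).

Lemma dot_ge0 x : 0 <= dot x x.
Proof. by apply: sumr_ge0 => i _; rewrite -expr2 sqr_ge0. Qed.

Lemma norm2_le x y : (norm2 x <= norm2 y) = (dot x x <= dot y y).
Proof. by rewrite /norm2 ler_psqrt // nnegrE dot_ge0. Qed.

Lemma is_proj_powers_le pmax x y (i : 'I_n) :
  is_proj (powers pmax) x y -> y 0 i <= Num.max (x 0 i) 0.
Proof.
move=> [[ysum y0] ymin]; set c := Num.max _ _; rewrite leNgt; apply/negP => ltcy.
pose q : 'rV[R]_n := \row_j if j == i then c else y 0 j.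
have c0 : 0 <= c by rewrite le_max lexx orbT.
have qP : powers pmax q.
  split=> [|j]; last by rewrite mxE; case: ifP.
  apply: le_trans ysum; apply: ler_sum => j _.
  by rewrite mxE; case: eqP => [->|//]; exact: ltW.
(* The two squared distances to [x] differ only in coordinate [i], where [q] is strictly nearer
   because [x 0 i <= c < y 0 i]. *)
have := ymin q qP; rewrite norm2_le /dot (bigD1 i) //= [leRHS](bigD1 i) //=.
rewrite [X in _ + X <= _](eq_bigr
  (fun j => (q - x) 0 j * (q - x) 0 j)); last first.
  by move=> j ji; rewrite !mxE (negPf ji).
rewrite lerD2r !mxE eqxx.
by move: ltcy; rewrite /c; case: (leP (x 0 i) 0) => xi ltcy; nra.
Qed.

Lemma power_sum_ge0 pmax p : powers pmax p -> 0 <= power_sum p.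
Proof. by case=> _ p0; exact: sumr_ge0. Qed.

Lemma Dmax_ge (D : 'I_n -> R) i : D i <= Dmax D.
Proof. exact: le_bigmax. Qed.

Lemma Dmax_ge0 (D : 'I_n -> R) : 0 <= Dmax D.
Proof. exact: bigmax_ge_id. Qed.

End Projection.

Section Queue.
Context {R : realType} {n : nat} {S : Type}.
Variables (pmax V : R) (Omega : set (R * S)) (omega : nat -> R * S).
Variables (grad : 'rV[R]_n -> R * S -> 'rV[R]_n) (D : 'I_n -> R).
Variables (Q : nat -> R) (p : nat -> 'rV[R]_n).
Hypotheses (pmax_ge0 : 0 <= pmax) (V_gt0 : 0 < V).
Hypothesis omegaP : forall t, (1 <= t)%N -> Omega (omega t).
Hypothesis e_ge0 : forall t, (1 <= t)%N -> 0 <= (omega t).1.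
Hypothesis grad_bound : forall q w i, powers pmax q -> Omega w ->
  `|grad q w 0 i| <= D i.
Hypothesis alg : algorithm1 pmax V grad omega Q p.

Lemma alg_powers t : powers pmax (p t.+1).
Proof.
case: t => [|t]; last by case: (alg_p alg t).
rewrite (alg_p1 alg); split=> [|i]; last by rewrite mxE.
by rewrite /power_sum big1 // => i _; rewrite mxE.
Qed.

Lemma alg_Q_le0 t : Q t <= 0.
Proof.
by case: t => [|t]; rewrite ?(alg_Q0 alg) // (alg_Q alg) ge_min lexx orbT.
Qed.

(** Both arguments of the minimum dominate the left side: the first since harvested energy is
    nonnegative, the second since [Q t <= 0]. *)
Lemma alg_Q_step t : Q t - power_sum (p t.+1) <= Q t.+1.
Proof.
rewrite (alg_Q alg) le_min; apply/andP; split.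
  by rewrite lerD2r lerDl e_ge0.
by rewrite subr_le0 (le_trans (alg_Q_le0 t)) // (power_sum_ge0 (alg_powers t)).
Qed.

Lemma alg_Q_drop t j : Q t - j%:R * pmax <= Q (t + j)%N.
Proof.
elim: j => [|j IH]; first by rewrite mul0r subr0 addn0.
have [ps _] := alg_powers (t + j).
have := alg_Q_step (t + j); rewrite addnS -natr1; lra.
Qed.

(** The threshold makes the queue term at most [- (Dmax D + pmax) / V]; the gradient term adds at
    most [Dmax D / V], leaving a drift of at most [- pmax / V] before projection. *)
Lemma alg_p_step t i : Q t.+1 <= - (V * (Dmax D + pmax)) ->
  p t.+2 0 i <= Num.max (p t.+1 0 i - pmax / V) 0.
Proof.
move=> Qle; apply: le_trans (is_proj_powers_le i (alg_p alg t)) _.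
rewrite ge_max !le_max lexx orbT andbT; apply/orP; left.
rewrite !mxE mulr1 -addrA lerD2l.
have gle : grad (p t.+1) (omega t.+1) 0 i <= Dmax D.
  apply: le_trans (ler_norm _) (le_trans _ (Dmax_ge D i)).
  by apply: grad_bound; [exact: alg_powers | exact: omegaP].
have -> : - (pmax / V) = V^-1 * Dmax D + (V ^+ 2)^-1 * - (V * (Dmax D + pmax)).
  by field; rewrite gt_eqF.
by apply: lerD; rewrite ler_pM2l // invr_gt0 ?exprn_gt0.
Qed.

Lemma alg_p_decay t k i :
  (forall j, (j < k)%N -> Q (t.+1 + j)%N <= - (V * (Dmax D + pmax))) ->
  p (t.+1 + k)%N 0 i <= Num.max (p t.+1 0 i - k%:R * (pmax / V)) 0.
Proof.
elim: k => [|k IH] Qle; first by rewrite mul0r subr0 addn0 le_max lexx.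
have {}IH := IH (fun j jk => Qle j (leqW jk)).
rewrite addnS; apply: le_trans (alg_p_step i (Qle k (ltnSn k))) _.
rewrite ge_max !le_max lexx orbT andbT.
move: IH; rewrite le_max -natr1 mulrDl mul1r => /orP[h|h]; apply/orP.
  by left; rewrite addSn in h *; lra.
by right; rewrite addSn in h *; have := divr_ge0 pmax_ge0 (ltW V_gt0); lra.
Qed.

(** Each coordinate starts at no more than [pmax], and [k >= V] decrements of [pmax / V] remove at
    least [pmax]. *)
Lemma alg_p_eq0 t k : V <= k%:R ->
  (forall j, (j < k)%N -> Q (t.+1 + j)%N <= - (V * (Dmax D + pmax))) ->
  power_sum (p (t.+1 + k)%N) = 0.
Proof.
move=> Vk Qle; rewrite /power_sum big1 // => i _; apply/eqP.
have [ps p0] := alg_powers t; have [_ q0] := alg_powers (t + k).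
rewrite eq_le q0 andbT (le_trans (alg_p_decay i Qle)) // ge_max lexx andbT subr_le0.
have pi_le : p t.+1 0 i <= pmax.
  apply: le_trans ps; rewrite /power_sum (bigD1 i) //= lerDl.
  by apply: sumr_ge0.
apply: le_trans pi_le _.
by rewrite mulrCA ler_peMr // ler_pdivlMr // mul1r.
Qed.

Lemma alg_Q_ge t k : V <= k%:R -> - (k%:R * (Dmax D + 2 * pmax)) <= Q t.
Proof.
move=> Vk; have D0 := Dmax_ge0 D; have k0 : 0 <= k%:R :> R by [].
have kD0 : 0 <= k%:R * Dmax D by exact: mulr_ge0.
have kp0 : 0 <= k%:R * pmax by exact: mulr_ge0.
elim: t => [|t IH].
  by rewrite (alg_Q0 alg) oppr_le0 mulr_ge0 // addr_ge0 // mulr_ge0.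
rewrite leNgt; apply/negP => Qlt.
(* In the first [k] slots the queue, starting from [0], cannot fall below [- k * pmax]. *)
have [tk|kt] := leqP t.+1 k.
  have := alg_Q_drop 0 t.+1; rewrite add0n (alg_Q0 alg) => Qd.
  have : t.+1%:R * pmax <= k%:R * pmax by rewrite ler_wpM2r // ler_nat.
  by lra.
(* Otherwise the [k] slots from [(t - k).+1] to [t] all exist. Going back from [t.+1] to any of them
   raises [Q] by at most [k * pmax], so [Q] is there still below [- k * (Dmax D + pmax)]. *)
have tE : t.+1 = ((t - k).+1 + k)%N by rewrite addSn subnK.
have Qle j : (j < k)%N -> Q ((t - k).+1 + j)%N <= - (V * (Dmax D + pmax)).
  move=> jk; have := alg_Q_drop ((t - k).+1 + j) (k - j).
  rewrite -addnA subnKC ?(ltnW jk) // -tE => Qd.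
  have : (k - j)%:R * pmax <= k%:R * pmax by rewrite ler_wpM2r // ler_nat leq_subr.
  have : V * (Dmax D + pmax) <= k%:R * (Dmax D + pmax).
    by rewrite ler_wpM2r // addr_ge0.
  by lra.
(* No power is spent in slot [t.+1], so [Q t <= Q t.+1], against the induction hypothesis. *)
have := alg_Q_step t; rewrite {1}tE (alg_p_eq0 Vk Qle) subr0 => Qt.
by have := lt_le_trans Qlt (le_trans IH Qt); rewrite ltxx.
Qed.

(** Shifting by [Emax] turns the cap [0] of the queue into the cap of the battery, so the two
    recursions coincide. *)
Lemma battery_Q Emax (E : nat -> R) :
  battery Emax omega p E -> E 0%N = Emax -> forall t, E t = Q t + Emax.
Proof.
move=> bat E0; elim=> [|t IH]; first by rewrite (alg_Q0 alg) add0r.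
rewrite bat IH (alg_Q alg) addr_minl add0r; congr Num.min; ring.
Qed.

End Queue.

Theorem theorem3 (R : realType) (n : nat) (S : Type) (pmax emax : R)
    (Omega : set (R * S)) (omega : nat -> R * S)
    (U : 'rV[R]_n -> R * S -> R) (grad : 'rV[R]_n -> R * S -> 'rV[R]_n)
    (D : 'I_n -> R) (V Emax : R)
    (Q E : nat -> R) (p : nat -> 'rV[R]_n)
    (n_ge1 : (1 <= n)%N) (pmax_gt0 : 0 < pmax) (emax_gt0 : 0 < emax)
    (omegaP : forall t, (1 <= t)%N -> Omega (omega t))
    (e_bound : forall t, (1 <= t)%N -> 0 <= (omega t).1 <= emax)
    (U_cont : forall w, Omega w -> {within powers pmax, continuous (U ^~ w)})
    (U_concave : forall w, Omega w -> concave_on (powers pmax) (U ^~ w))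
    (U_subgrad : forall q w, powers pmax q -> Omega w ->
       is_subgradient (powers pmax) (U ^~ w) q (grad q w))
    (D_gt0 : forall i, 0 < D i)
    (grad_bound : forall q w i, powers pmax q -> Omega w ->
       `|grad q w 0 i| <= D i)
    (V_gt0 : 0 < V)
    (alg : algorithm1 pmax V grad omega Q p)
    (bat : battery Emax omega p E)
    (E0 : E 0%N = Emax)
    (Emax_ge : Qlow V pmax emax D + pmax <= Emax) :
  (forall t, (1 <= t)%N -> power_sum (p t) <= E t.-1) /\
  (forall t, E t = Q t + Emax).
Proof.
have e_ge0 t : (1 <= t)%N -> 0 <= (omega t).1 by move/e_bound => /andP[].
have EQ := battery_Q alg bat E0; split=> // -[//|t] _ /=.
(* As [V > 0], its ceiling is a natural number and can serve as the window length [k]. *)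
have [k kE] : exists k : nat, Num.ceil V = k%:Z.
  by exists `|Num.ceil V|%N; rewrite gez0_abs // ltW // ceil_gt0.
have Vk : V <= k%:R by have := ceil_ge V; rewrite kE.
have := alg_Q_ge (ltW pmax_gt0) V_gt0 omegaP e_ge0 grad_bound alg t Vk.
have [ps _] := alg_powers (ltW pmax_gt0) alg t.
(* The lower bound on [Q t] and the capacity give [E t >= k * emax + pmax], and a slot spends at
   most [pmax]. *)
move: Emax_ge; rewrite /Qlow kE -pmulrn EQ.
have : 0 <= k%:R * emax by rewrite mulr_ge0 // ltW.
lra.
Qed.
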